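(* Let $X$ be an infinite Tychonoff space and let $o(X)$ denote the cardinality of the family of all open sets in $X$. If $o(X)^{\aleph_0}\le |X|$, then $X$ is not a $\Delta$-space.
   Context: A topological space $X$ is a $\Delta$-space if for every decreasing sequence $\{D_n:n\in\omega\}$ of subsets of $X$ with empty intersection there is a decreasing sequence $\{V_n:n\in\omega\}$ of open subsets of $X$, also with empty intersection, such that $D_n\subseteq V_n$ for every $n\in\omega$. *)

(* Defs.v *)
From mathcomp Require Import all_boot all_order.
From mathcomp Require Import classical_sets cardinality.
From mathcomp Require Import topology sequences normedtype.

Set Implicit Arguments.
Unset Strict Implicit.
Unset Printing Implicit Defensive.

Local Open Scope classical_set_scope.

(* By [uniform_separatorP], [completely_regular_space X] amounts to separation
   of points from closed sets by continuous functions into [0, 1]. *)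
Definition tychonoff_space (X : topologicalType) : Prop :=
  accessible_space X /\ completely_regular_space X.

(* The order on [set X] is inclusion, so [nonincreasing_seq D] says that
   [D m `<=` D n] whenever [n <= m]; strictness is not required. *)
Definition delta_space (X : topologicalType) : Prop :=
  forall D : nat -> set X,
    nonincreasing_seq D -> \bigcap_n D n = set0 ->
    exists V : nat -> set X,
      [/\ nonincreasing_seq V, forall n, open (V n),
          \bigcap_n V n = set0 & forall n, D n `<=` V n].

Definition open_sets (X : topologicalType) : set (set X) :=
  [set U | open U].
Arguments open_sets X : clear implicits.

(* The sequences with all terms in [A]: a set of cardinality |A|^aleph_0. *)
Definition sequences_in (T : Type) (A : set T) : set (nat -> T) :=
  [set u | forall n, A (u n)].

(* Main.v *)
Require Import Defs.
From mathcomp Require Import all_boot all_order.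
From mathcomp Require Import classical_sets cardinality.
From mathcomp Require Import topology.
From mathcomp Require Import boolp sequences.

Local Open Scope classical_set_scope.
Local Open Scope card_scope.

(** The proof is Cantor's diagonal argument.  The cardinality hypothesis says
    that the points of the space suffice to enumerate, as [g : X -> nat -> set X],
    all sequences of open sets.  The diagonal is the decreasing sequence
    [diagonal g] below: a point [x] that is outside some [g x k] belongs to it up
    to and including the first such [k], and no further, so the intersection is
    empty.  If the space were a Delta-space, some sequence [V] of open sets with
    empty intersection would cover the diagonal term by term.  But [V] is [g x]
    for some [x], and at the first [k] with [x] outside [V k] this [x] still lies
    in the [k]-th term of the diagonal. *)

(** The first conjunct removes the points that lie in every term of the sequence
    they index; they would otherwise survive in the intersection. *)
Definition diagonal {T : Type} (g : T -> nat -> set T) (n : nat) : set T :=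
  [set x | (exists k, ~ g x k x) /\ forall m, (m < n)%N -> g x m x].

Lemma diagonal_nonincreasing (T : Type) (g : T -> nat -> set T) :
  nonincreasing_seq (diagonal g).
Proof.
move=> n m le_nm; apply/subsetPset => x [gx lt_gx]; split=> // i lt_in.
exact/lt_gx/(leq_trans lt_in).
Qed.

Lemma bigcap_diagonal (T : Type) (g : T -> nat -> set T) :
  \bigcap_n diagonal g n = set0.
Proof.
rewrite -subset0 => x Dx; have [[k ngx] _] := Dx 0 I.
by apply: ngx; have [_] := Dx k.+1 I; apply.
Qed.

(** If [x] has been in [g x m] for all [m < n], then it is still in the [n]-th
    diagonal set, hence in [g x n]; by strong induction [x] would lie in every
    [g x n]. *)
Lemma diagonal_not_covered (T : Type) (g : T -> nat -> set T) (x : T) :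
  \bigcap_n g x n = set0 -> ~ (forall n, diagonal g n `<=` g x n).
Proof.
move=> gx0 Dg; have ngx : ~ forall k, g x k x.
  by move=> gx; have : (\bigcap_n g x n) x by []; rewrite gx0.
apply: (ngx); elim/ltn_ind => n gx.
by apply: Dg; split=> //; apply/existsNP.
Qed.

Theorem theorem6p1 (X : topologicalType)
    (infX : infinite_set [set: X])
    (tychX : tychonoff_space X)
    (cardX : sequences_in (open_sets X) #<= [set: X]) :
  ~ delta_space X.
Proof.
move=> deltaX.
have /pcard_surjP[g surj_g] := cardX.
have [V [_ Vopen V0 DV]] :=
  deltaX _ (diagonal_nonincreasing _ g) (bigcap_diagonal _ g).
have [x _ gxV] := surj_g V Vopen.
by apply: (diagonal_not_covered _ g x); rewrite gxV.
Qed.
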